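(* For all admissible $z,z'$ the point process $\mathcal P_{zz'}$ is simple; equivalently, for every $n\ge2$ the set $\{(x_1,\dots,x_n)\in I^n:\prod_{i<j}(x_i-x_j)=0\}$ is a null set for the $n$-th correlation measure of $\mathcal P_{zz'}$.
   Context: Thoma simplex $\Omega$: pairs of sequences $(\alpha|\beta)$, $\alpha_1\ge\alpha_2\ge\dots\ge0$, $\beta_1\ge\beta_2\ge\dots\ge0$, $\sum_i(\alpha_i+\beta_i)\le1$; $\Omega_0$ the subset where the sum is $1$. Admissible parameters: $z'=\bar z$, $z\notin\mathbb Z$, or $z,z'\in\mathbb R$ with $m<z,z'<m+1$ for some $m\in\mathbb Z$; $t=zz'$, $(a)_k=\Gamma(a+k)/\Gamma(a)$. $P^{(n)}_{zz'}$ is the probability measure on $\Omega_0$ supported on points $\alpha_i=(p_i+1/2)/n$, $\beta_i=(q_i+1/2)/n$ ($i\le d$), zero otherwise, with integers $p_1>\dots>p_d\ge0$, $q_1>\dots>q_d\ge0$, $\sum_i(p_i+q_i+1)=n$, of mass $\frac{n!\,t^d}{(t)_n}\prod_{i=1}^d\frac{(z+1)_{p_i}(z'+1)_{p_i}(-z+1)_{q_i}(-z'+1)_{q_i}}{(p_i!)^2(q_i!)^2}\big(\det[\frac1{p_i+q_j+1}]\big)^2$; it is known that these converge weakly to a probability measure $P_{zz'}$ on $\Omega$. The process $\mathcal P_{zz'}$: to $(\alpha|\beta)\sim P_{zz'}$ associate the configuration on $I=[-1,1]\setminus\{0\}$ of the points $\alpha_i$ ($\alpha_i\ne0$) and $-\beta_i$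 ($\beta_i\neq0$), indexed by $i$ (counted with multiplicity). Its $n$-th correlation measure assigns to a Borel $A\subset I^n$ the expected number of ordered $n$-tuples of pairwise distinct indices whose points lie in $A$. Simple means that almost surely no two indexed points coincide. *)

(* Defs.v *)
From HB Require Import structures.
From mathcomp Require Import all_boot all_order all_algebra.
From mathcomp Require Import all_classical all_reals all_analysis.
From mathcomp Require Import complex.

Set Implicit Arguments.
Unset Strict Implicit.
Unset Printing Implicit Defensive.

Import Order.TTheory GRing.Theory Num.Theory.
Import numFieldNormedType.Exports.
Local Open Scope classical_set_scope.
Local Open Scope ring_scope.

Definition pt (R : realType) := ((nat -> R) * (nat -> R))%type.

Definition thoma (R : realType) (w : pt R) : Prop :=
  (forall i, 0 <= w.1 i.+1 <= w.1 i) /\ (forall i, 0 <= w.2 i.+1 <= w.2 i) /\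
  (forall N, \sum_(i < N) (w.1 i + w.2 i) <= 1).

Definition admissible (R : realType) (z z' : R[i]) : Prop :=
  (z' = conjc z /\ forall k : int, z != k%:~R) \/
  (complex.Im z = 0 /\ complex.Im z' = 0 /\
   exists m : int, m%:~R < complex.Re z < (m + 1)%:~R /\ m%:~R < complex.Re z' < (m + 1)%:~R).

Definition poch (F : comNzRingType) (a : F) (k : nat) : F :=
  \prod_(i < k) (a + i%:R).

Definition dec_list (n : nat) (A : {set 'I_n}) : seq nat :=
  sort (fun a b => b <= a)%N [seq val x | x <- enum A].

(* Admissible index data for P^(n): a pair (P, Q) of sets of naturals,
   P = {p_1 > ... > p_d}, Q = {q_1 > ... > q_d}, with
   sum_i (p_i + q_i + 1) = n.  (All p_i, q_i are then < n.) *)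
Definition frob_ok (n : nat) (PQ : {set 'I_n} * {set 'I_n}) : bool :=
  (#|PQ.1| == #|PQ.2|) &&
  (\sum_(p in PQ.1) (val p) + \sum_(q in PQ.2) (val q) + #|PQ.1| == n)%N.

Definition frob_point (R : realType) (n : nat) (PQ : {set 'I_n} * {set 'I_n})
  : pt R :=
  let ps := dec_list PQ.1 in let qs := dec_list PQ.2 in
  (fun i => if (i < size ps)%N then ((nth 0%N ps i)%:R + 2^-1) / n%:R else 0,
   fun i => if (i < size qs)%N then ((nth 0%N qs i)%:R + 2^-1) / n%:R else 0).

Definition frob_mass (R : realType) (z z' : R[i]) (n : nat)
  (PQ : {set 'I_n} * {set 'I_n}) : R :=
  let ps := dec_list PQ.1 in let qs := dec_list PQ.2 in
  let d := size ps in
  let t := z * z' in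
  let cauchy : 'M[R[i]]_d :=
    \matrix_(i < d, j < d) ((nth 0%N ps i + nth 0%N qs j + 1)%:R)^-1 in
  complex.Re ( (n`!)%:R * t ^+ d / poch t n *
       (\prod_(i < d)
          (poch (z + 1) (nth 0%N ps i) * poch (z' + 1) (nth 0%N ps i) *
           poch (- z + 1) (nth 0%N qs i) * poch (- z' + 1) (nth 0%N qs i) /
           (((nth 0%N ps i)`! ^ 2)%:R * ((nth 0%N qs i)`! ^ 2)%:R))) *
       (\det cauchy) ^+ 2 ).

Definition frob_expect (R : realType) (z z' : R[i]) (n : nat) (f : pt R -> R)
  : R :=
  \sum_(PQ : {set 'I_n} * {set 'I_n} | frob_ok PQ)
     frob_mass z z' PQ * f (frob_point R PQ).

(* Continuity of f on Omega for the topology of coordinatewise convergence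
   (Omega is compact metrizable, so sequential continuity is continuity). *)
Definition cont_on_thoma (R : realType) (f : pt R -> R) : Prop :=
  forall (x : nat -> pt R) (y : pt R),
    (forall k, thoma (x k)) -> thoma y ->
    (forall i, (fun k => (x k).1 i) @ \oo --> y.1 i) ->
    (forall i, (fun k => (x k).2 i) @ \oo --> y.2 i) ->
    (fun k => f (x k)) @ \oo --> f y.

(* Simplicity of the configuration {alpha_i != 0} U {-beta_i != 0}
   (indexed points): no two distinct indices carry the same point.
   (alpha_i > 0 > -beta_j, so only alpha-alpha and beta-beta clashes matter.) *)
Definition simple_config (R : realType) (w : pt R) : Prop :=
  forall i j : nat, i <> j ->
    (w.1 i != 0 -> w.1 i != w.1 j) /\ (w.2 i != 0 -> w.2 i != w.2 j).

(* Main.v *)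
Require Import Defs.
From HB Require Import structures.
From mathcomp Require Import all_boot all_order all_algebra.
From mathcomp Require Import all_classical all_reals all_analysis.
From mathcomp Require Import complex measurable_realfun.
From mathcomp Require Import zify ring lra.

(** Let P be the set of the numbers p_i of a random point of P^(n).  The squared
    Cauchy determinant and the Pochhammer factors give a weight in which the
    dependence on one element x of P is w(x) * (prod_a |x - a| / prod_q (x + q + 1))^2,
    the factor w varying slowly at scale n.  If p > p' are two elements of P of
    order n with p - p' < n / J, replace them by p + k and p' - k.  For a positive
    proportion of all k <= const * n the two new elements are at distance of order n
    from all the other elements of order n (of which there are boundedly many), and
    then the weight decreases at most by a constant factor.  A given image arises
    from O(n / J) pairs, because p + p' is known.  Hence the mass of the configurations
    with such a pair is O(1 / J) uniformly in n; a continuous test function passes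
    this bound to the limit, and J is arbitrary. *)

Set Implicit Arguments.
Unset Strict Implicit.
Unset Printing Implicit Defensive.

Import Order.TTheory GRing.Theory Num.Theory.
Import numFieldNormedType.Exports.
Local Open Scope ring_scope.

(** * The squared Cauchy determinant as a product *)

Lemma prod_neq_symmetric (R : comPzRingType) (d : nat) (g : 'I_d -> 'I_d -> R) :
  (forall i j, g i j = g j i) ->
  \prod_i \prod_(j | j != i) g i j = (\prod_(i < d) \prod_(j < d | (i < j)%N) g i j) ^+ 2.
Proof.
move=> gC; rewrite expr2 [X in _ = _ * X](exchange_big_dep predT) //= -big_split /=.
apply: eq_bigr => i _; rewrite (bigID (fun j : 'I_d => (i < j)%N)) /=.
congr (_ * _).
  by apply: eq_bigl => j; rewrite -val_eqE /=; lia.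
by apply: eq_big => j; [rewrite -val_eqE /=; lia | move=> _; rewrite gC].
Qed.

(* With L_j = prod_(k != j) ('X + y_k), the matrix (L_j(x_i)) is both the Cauchy
   matrix with row i scaled by prod_k (x_i + y_k) and Vandermonde(x) times the
   coefficient matrix of the L_j; evaluating at -y instead makes it diagonal. *)
Lemma sqr_det_cauchy (F : realFieldType) (d : nat) (x y : 'I_d -> F) :
  injective y -> (forall i j, x i + y j != 0) ->
  (\det (\matrix_(i, j) (x i + y j)^-1)) ^+ 2 *
    (\prod_i \prod_j (x i + y j)) ^+ 2 =
  (\prod_i \prod_(j | j != i) `|x i - x j|) *
  (\prod_i \prod_(j | j != i) `|y i - y j|).
Proof.
move=> y_inj xy0.
pose Lg j : {poly F} := \prod_(k | k != j) ('X + (y k)%:P).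
(* [Lg j] has only [d - 1] linear factors, so [d] coefficients determine it and the coefficient
   matrix is square. *)
have sizeL j : (size (Lg j) <= d)%N.
  apply: leq_trans (size_poly_prod_leq _ _) _.
  under eq_bigr do rewrite size_XaddC.
  rewrite sum_nat_const cardC1 card_ord; have := ltn_ord j; lia.
have evalL (c : 'I_d -> F) i j :
    ((Vandermonde d (\row_k c k))^T *m \matrix_(k, l) (Lg l)`_k) i j =
    \prod_(k | k != j) (c i + y k).
  rewrite mxE.
  transitivity (Lg j).[c i]; last first.
    by rewrite horner_prod; apply: eq_bigr => k _; rewrite !hornerE.
  rewrite (horner_coef_wide _ (sizeL j)); apply: eq_bigr => k _.
  by rewrite !mxE mulrC.
pose V (c : 'I_d -> F) := Vandermonde d (\row_k c k).
pose C : 'M[F]_d := \matrix_(k, l) (Lg l)`_k.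
have detV c : (\det (V c)) ^+ 2 = \prod_i \prod_(j | j != i) `|c i - c j|.
  rewrite det_Vandermonde prod_neq_symmetric; last by move=> i j; rewrite distrC.
  rewrite -!prodrXl; apply: eq_bigr => i _.
  rewrite -!prodrXl; apply: eq_bigr => j _.
  by rewrite !mxE real_normK ?num_real // -sqrrN opprB.
have detx : \det (\matrix_(i, j) (x i + y j)^-1) * (\prod_i \prod_j (x i + y j)) =
    \det (V x) * \det C.
  rewrite -[\det (V x)]det_tr -det_mulmx mulrC.
  rewrite (_ : \prod_i _ = \det (diag_mx (\row_i \prod_j (x i + y j)))); last first.
    by rewrite det_diag; apply: eq_bigr => i _; rewrite mxE.
  rewrite -det_mulmx; congr (\det _); apply/matrixP => i j.
  rewrite evalL mul_diag_mx !mxE (bigD1 j) //= mulrAC mulfV ?mul1r //.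
have dety : \det (V (fun i => - y i)) * \det C =
    \prod_i \prod_(j | j != i) (y j - y i).
  rewrite -[\det (V _)]det_tr -det_mulmx.
  rewrite (_ : _ *m _ = diag_mx (\row_i \prod_(j | j != i) (y j - y i))).
    by rewrite det_diag; apply: eq_bigr => i _; rewrite mxE.
  apply/matrixP => i j; rewrite evalL !mxE.
  have [->|nij] := eqVneq i j; first by apply: eq_bigr => k _; rewrite addrC.
  by rewrite mulr0n (bigD1 i) //= addNr mul0r.
have dety2 : \det (V (fun i => - y i)) ^+ 2 = \prod_i \prod_(j | j != i) `|y i - y j|.
  rewrite detV; apply: eq_bigr => i _; apply: eq_bigr => j _.
  by rewrite -opprD normrN.
have gap0 : \prod_i \prod_(j | j != i) `|y i - y j| != 0.
  apply/prodf_neq0 => i _; apply/prodf_neq0 => j nij.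
  by rewrite normr_eq0 subr_eq0 (inj_eq y_inj) eq_sym.
rewrite -exprMn detx exprMn detV; congr (_ * _).
(* [\det C] is never computed: the square of its product with the Vandermonde at [-y] is known, and
   a factor nonzero by [gap0] cancels. *)
apply: (mulfI gap0); rewrite -{1}dety2 -exprMn dety -expr2.
rewrite -[LHS]real_normK ?num_real // normr_prod; congr (_ ^+ 2); apply: eq_bigr => i _.
by rewrite normr_prod; apply: eq_bigr => j _; rewrite distrC.
Qed.

(** * The weight of a configuration and its dependence on one element *)

Section Interaction.
Variables (R : realType) (n : nat).
Implicit Types (A B P Q : {set 'I_n}) (x : 'I_n).

(** The pairs are ordered, so this is the squared Vandermonde determinant of [P]. *)
Definition gap_prod P : R :=
  \prod_(x in P) \prod_(y in P | y != x) `|x%:R - y%:R|.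

Definition cross_prod P Q : R :=
  \prod_(x in P) \prod_(y in Q) (x + y + 1)%:R.

(** Adding a new element [x] multiplies the weight by [w x] times the square of this. *)
Definition interaction P Q (x : nat) : R :=
  (\prod_(a in P) `|x%:R - a%:R|) / \prod_(b in Q) (x + b + 1)%:R.

(** For [P] and [Q] of equal size the last factor is the squared Cauchy determinant with entries
    [1 / (p + q + 1)]. *)
Definition frob_weight (w w' : nat -> R) P Q : R :=
  (\prod_(p in P) w p) * (\prod_(q in Q) w' q) *
  (gap_prod P * gap_prod Q / cross_prod P Q ^+ 2).

Lemma gap_prod_setU1 x A : x \notin A ->
  gap_prod (x |: A) = (\prod_(a in A) `|x%:R - a%:R|) ^+ 2 * gap_prod A.
Proof.
move=> xA; rewrite /gap_prod big_setU1 //=.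
have xneq y : y \in A -> y != x by move=> yA; apply: contraNneq xA => <-.
rewrite (eq_bigl (fun y => y \in A)); last first.
  by move=> y; rewrite !inE; have [->|_] := eqVneq y x; rewrite ?(negbTE xA) ?andbT.
rewrite expr2 -mulrA; congr (_ * _); rewrite -big_split /=.
apply: eq_bigr => y yA.
rewrite (bigD1 x) /=; last by rewrite !inE eqxx eq_sym xneq.
rewrite distrC; congr (_ * _); apply: eq_bigl => z.
by rewrite !inE; have [->|_] := eqVneq z x; rewrite ?(negbTE xA) ?andbT ?andbF.
Qed.

Lemma cross_prod_setU1 x A Q : x \notin A ->
  cross_prod (x |: A) Q = (\prod_(b in Q) (x + b + 1)%:R) * cross_prod A Q.
Proof. by move=> xA; rewrite /cross_prod big_setU1. Qed.

Lemma frob_weight_setU1 (w w' : nat -> R) x A Q : x \notin A ->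
  frob_weight w w' (x |: A) Q =
  frob_weight w w' A Q * (w x * interaction A Q x ^+ 2).
Proof.
move=> xA; rewrite /frob_weight gap_prod_setU1 // cross_prod_setU1 // big_setU1 //=.
rewrite /interaction -!exprVn !invfM; ring.
Qed.

Lemma interaction_setU1 x A Q y : x \notin A ->
  interaction (x |: A) Q y = `|y%:R - x%:R| * interaction A Q y.
Proof. by move=> xA; rewrite /interaction big_setU1 //= mulrA. Qed.

Lemma frob_weight_ge0 (w w' : nat -> R) P Q :
  (forall k, 0 < w k) -> (forall k, 0 < w' k) -> 0 <= frob_weight w w' P Q.
Proof.
move=> w0 w'0; rewrite /frob_weight.
have gap0 S : 0 <= gap_prod S by apply: prodr_ge0 => i _; apply: prodr_ge0.
rewrite !mulr_ge0 ?invr_ge0 ?sqr_ge0 //.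
  by apply: prodr_ge0 => i _; apply: ltW.
by apply: prodr_ge0 => i _; apply: ltW.
Qed.

Lemma interaction_ge0 P Q (x : nat) : 0 <= interaction P Q x.
Proof. by rewrite mulr_ge0 ?invr_ge0 ?prodr_ge0. Qed.

(* Each factor |x - a| is at most x * exp (a / x). *)
Lemma interaction_le A Q (x : nat) : (0 < x)%N ->
  (\sum_(a in A) a <= n)%N -> #|Q| = (#|A| + 2)%N ->
  interaction A Q x <= expR (n%:R / x%:R) / x%:R ^+ 2.
Proof.
move=> x0 sA cQ; have xR : 0 < x%:R :> R by rewrite ltr0n.
have numer : \prod_(a in A) `|x%:R - a%:R| <= x%:R ^+ #|A| * expR (n%:R / x%:R) :> R.
  apply: (@le_trans _ _ (\prod_(a in A) (x%:R * expR (a%:R / x%:R)))).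
    apply: ler_prod => a _; rewrite normr_ge0 /=.
    apply: (@le_trans _ _ (x%:R * (1 + a%:R / x%:R))).
      rewrite mulrDr mulr1 mulrCA mulfV ?gt_eqF // mulr1.
      have : 0 <= a%:R :> R by []. 
      by rewrite ler_norml; move=> ?; apply/andP; split; lra.
    by rewrite ler_pM2l // expR_ge1Dx.
  rewrite big_split /= prodr_const ler_pM2l ?exprn_gt0 // -expR_sum ler_expR.
  by rewrite -mulr_suml ler_pM2r ?invr_gt0 // -natr_sum ler_nat.
have denom : x%:R ^+ #|Q| <= \prod_(b in Q) (x + b + 1)%:R :> R.
  rewrite -prodr_const; apply: ler_prod => b _; rewrite ler0n ler_nat; lia.
rewrite /interaction ler_pdivrMr; last by apply: lt_le_trans denom; rewrite exprn_gt0.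
apply: (le_trans numer); rewrite [leRHS]mulrC.
(* The two surplus elements of [Q] leave [x ^ -2]; in the application [A] is the first set without
   its two moving elements. *)
apply: (@le_trans _ _ (x%:R ^+ #|Q| * (expR (n%:R / x%:R) / x%:R ^+ 2))).
  rewrite cQ exprD mulrACA [_ ^+ 2 / _]mulfV ?expf_neq0 ?gt_eqF // mulr1 //.
by rewrite ler_pM2r // divr_gt0 ?expR_gt0 ?exprn_gt0.
Qed.

(** On this range [(1 - y) * (1 + 2 * y) >= 1], and [1 + 2 * y <= expR (2 * y)]. *)
Lemma expR_lower_half (y : R) : 0 <= y -> y <= 2^-1 -> expR (- (2 * y)) <= 1 - y.
Proof.
move=> y0 y2; rewrite expRN -[leLHS]mul1r ler_pdivrMr ?expR_gt0 //.
apply: (@le_trans _ _ ((1 - y) * (1 + 2 * y))); first by nra.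
by rewrite ler_pM2l ?expR_ge1Dx //; lra.
Qed.

(* Far from x, |x - a| >= x * exp (- 2 L a / x); for a > x / 2 this is the
   separation hypothesis, and for a <= x / 2 it is 1 - y >= exp (- 2 y). *)
Lemma interaction_ge A Q (x : nat) (L : R) : (0 < x)%N -> 1 <= L ->
  (\sum_(a in A) a <= n)%N -> (\sum_(b in Q) (b + 1) <= n)%N ->
  #|Q| = (#|A| + 2)%N ->
  (forall a, a \in A -> (x < 2 * a)%N -> x%:R * expR (- L) <= `|x%:R - a%:R|) ->
  expR (- ((2 * L + 1) * (n%:R / x%:R))) / x%:R ^+ 2 <= interaction A Q x.
Proof.
move=> x0 L1 sA sQ cQ far; have xR : 0 < x%:R :> R by rewrite ltr0n.
have nx0 : x%:R != 0 :> R by rewrite gt_eqF.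
have numer : x%:R ^+ #|A| * expR (- (2 * L * (n%:R / x%:R))) <=
    \prod_(a in A) `|x%:R - a%:R| :> R.
  apply: (@le_trans _ _ (\prod_(a in A) (x%:R * expR (- (2 * L * (a%:R / x%:R)))))).
    rewrite big_split /= prodr_const ler_pM2l ?exprn_gt0 // -expR_sum ler_expR.
    rewrite sumrN lerN2 -mulr_sumr -mulr_suml ler_pM2l; last lra.
    by rewrite ler_pM2r ?invr_gt0 // -natr_sum ler_nat.
  apply: ler_prod => a aA; rewrite mulr_ge0 ?expR_ge0 //=.
  have [xa|ax] := ltnP x (2 * a).
    apply: le_trans (far a aA xa); rewrite ler_pM2l // ler_expR lerN2.
    rewrite -[leLHS]mulr1 [2 * L]mulrC -mulrA ler_pM2l; last lra.
    by rewrite mulrA ler_pdivlMr // mul1r -natrM ler_nat ltnW.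
  have y0 : 0 <= a%:R / x%:R :> R by rewrite divr_ge0.
  have y2 : a%:R / x%:R <= 2^-1 :> R.
    by rewrite ler_pdivrMr // mulrC ler_pdivlMr // mulrC -natrM ler_nat.
  apply: (@le_trans _ _ (x%:R * (1 - a%:R / x%:R))).
    rewrite ler_pM2l //; apply: le_trans (expR_lower_half y0 y2).
    by rewrite ler_expR lerN2; nra.
  by rewrite mulrBr mulr1 mulrCA mulfV // mulr1 ler_norm.
have denom : \prod_(b in Q) (x + b + 1)%:R <= x%:R ^+ #|Q| * expR (n%:R / x%:R) :> R.
  apply: (@le_trans _ _ (\prod_(b in Q) (x%:R * expR ((b + 1)%:R / x%:R)))).
    apply: ler_prod => b _; rewrite ler0n /=.
    apply: (@le_trans _ _ (x%:R * (1 + (b + 1)%:R / x%:R))).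
      by rewrite mulrDr mulr1 mulrCA mulfV // mulr1 -addnA natrD.
    by rewrite ler_pM2l // expR_ge1Dx.
  rewrite big_split /= prodr_const ler_pM2l ?exprn_gt0 // -expR_sum ler_expR.
  by rewrite -mulr_suml ler_pM2r ?invr_gt0 // -natr_sum ler_nat.
rewrite /interaction ler_pdivlMr; last first.
  by apply: prodr_gt0 => b _; rewrite ltr0n addn1.
apply: le_trans numer.
apply: le_trans (ler_wpM2l _ denom) _.
  by rewrite mulr_ge0 ?expR_ge0 // invr_ge0 exprn_ge0.
rewrite cQ exprD mulrDl mul1r opprD expRD [expR (- (n%:R / _))]expRN.
have e0 : expR (n%:R / x%:R) != 0 :> R by rewrite gt_eqF ?expR_gt0.
rewrite le_eqVlt; apply/orP; left; apply/eqP; field.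
by rewrite nx0 e0.
Qed.

End Interaction.

(** * Double counting of weighted moves *)

Section DoubleCounting.
Variables (R : realDomainType) (S I : finType) (W : S -> R).
Variables (ok bad : pred S) (good : S -> I -> bool) (move : S -> I -> S).

(** Sum [W s] over the pairs of a bad [s] and a good move [i]: each [s] occurs at least [g] times.
    Bounding [W s] by [C * W (move s i)] and grouping by image, each [t] occurs at most [m]
    times. *)
Lemma double_counting (g : R) (m : nat) (C : R) :
  0 <= C -> (forall s, ok s -> 0 <= W s) -> (forall s, bad s -> ok s) ->
  (forall s, bad s -> g <= #|[set i | good s i]|%:R) ->
  (forall s i, bad s -> good s i ->
     ok (move s i) /\ W s <= C * W (move s i)) ->
  (forall t, ok t ->
     #|[set x : S * I | bad x.1 && good x.1 x.2 && (move x.1 x.2 == t)]| <= m)%N ->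
  g * (\sum_(s | bad s) W s) <= C * m%:R * (\sum_(s | ok s) W s).
Proof.
move=> C0 W0 bad_ok many moveP few.
apply: (@le_trans _ _ (\sum_(s | bad s) \sum_(i | good s i) C * W (move s i))).
  rewrite mulr_sumr; apply: ler_sum => s bs.
  apply: (@le_trans _ _ (\sum_(i | good s i) W s)).
    rewrite sumr_const -[leRHS]mulr_natl ler_wpM2r ?W0 ?bad_ok //.
    by have := many s bs; rewrite cardsE.
  by apply: ler_sum => i gi; have [] := moveP s i bs gi.
rewrite pair_big_dep /= (partition_big (fun x => move x.1 x.2) ok) /=; last first.
  by move=> x /andP[bx gx]; have [] := moveP _ _ bx gx.
rewrite mulr_sumr; apply: ler_sum => t okt.
under eq_bigr => x /andP[_ /eqP ->] do over.
rewrite sumr_const -[leLHS]mulr_natl mulrA [C * m%:R]mulrC.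
rewrite !ler_wpM2r ?W0 // ler_nat.
by have := few t okt; rewrite cardsE.
Qed.

End DoubleCounting.

(** * Counting the positions far from all large elements *)

Section Counting.
Variable n : nat.
Implicit Types (A P Q : {set 'I_n}).

(** Markov's inequality: each counted [a] contributes at least [n] to the sum of [k * a], which is
    at most [k * n]. *)
Lemma card_large A (k : nat) : (0 < n)%N -> (\sum_(a in A) a <= n)%N ->
  (#|[set a in A | n <= k * a]| <= k)%N.
Proof.
move=> n0 sA; rewrite -(leq_pmul2r n0) -sum_nat_const.
apply: (@leq_trans (\sum_(a in A) k * a)); last by rewrite -big_distrr leq_mul2l sA orbT.
rewrite [leqRHS](bigID (fun a : 'I_n => (n <= k * a)%N)) /=.
apply: leq_trans (leq_addr _ _).
rewrite [leqLHS](eq_bigl (fun a => (a \in A) && (n <= k * a)%N)).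
  by apply: leq_sum => a /andP[].
by move=> a; rewrite inE.
Qed.

Lemma card_ord_interval (lo hi : nat) :
  (#|[set v : 'I_n | lo <= v < hi]| <= hi - lo)%N.
Proof.
rewrite -(size_iota lo (hi - lo)) cardE -(size_map val).
apply: uniq_leq_size; first by rewrite map_inj_uniq ?enum_uniq //; apply: val_inj.
move=> k /mapP[v]; rewrite mem_enum inE => /andP[l h] ->; rewrite mem_iota /=.
by rewrite l /= subnKC // (leq_trans l (ltnW h)).
Qed.

Lemma card_ord_interval_ge (lo hi : nat) : (hi <= n)%N ->
  (hi - lo <= #|[set v : 'I_n | lo <= v < hi]|)%N.
Proof.
move=> hn; rewrite -(size_iota lo (hi - lo)) cardE -(size_map val).
apply: uniq_leq_size; first exact: iota_uniq.
move=> k; rewrite mem_iota => /andP[l h].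
have kn : (k < n)%N by lia.
by apply/mapP; exists (Ordinal kn); rewrite // mem_enum inE /=; lia.
Qed.

Lemma card_bigcup_leq (T : finType) (J : finType) (D : {set J}) (F : J -> {set T}) :
  (#|\bigcup_(j in D) F j| <= \sum_(j in D) #|F j|)%N.
Proof.
elim/big_ind2: _ => [|x A y B xA yB|//]; first by rewrite cards0.
exact: leq_trans (leq_card_setU _ _) (leq_add xA yB).
Qed.

Variable M : nat.

(** The two truncated differences add up to the distance of [x] and [a]. The threshold [n / (4 * M)]
    covers every [a > x / 2] once [x >= n / (2 * M)], as the lower bound on [interaction]
    requires. *)
Definition well_separated A (x : nat) : bool :=
  [forall a in A, (n <= 4 * M * a)%N ==>
     (n <= 128 * M ^ 2 * ((x - a) + (a - x)))%N].

Lemma well_separatedP A x : reflect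
  (forall a, a \in A -> (n <= 4 * M * a)%N ->
     (n <= 128 * M ^ 2 * ((x - a) + (a - x)))%N)
  (well_separated A x).
Proof.
apply: (iffP forall_inP) => [H a aA|H a aA]; first by move/implyP: (H a aA).
by apply/implyP; apply: H.
Qed.

(** Among about [n / (2 * M)] candidates just below [p'], each of the at most [4 * M] large elements
    of [A] spoils at most [4 * h], in total at most [n / (4 * M)]. *)
Lemma many_well_separated A (p p' : nat) :
  (0 < M)%N -> (64 * M ^ 2 <= n)%N -> (\sum_(a in A) a <= n)%N ->
  (n <= M * p')%N -> (p' <= n)%N ->
  (n <= 8 * M * #|[set v : 'I_n | [&& v < p', p' <= 2 * v,
                     well_separated A v & well_separated A (p + p' - v)]]|)%N.
Proof.
move=> M0 nM sA np p'n; set good := [set v | _].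
(* [E] is the length of the window of candidates, short enough that [2 * E <= p']; [h] is the
   forbidden radius, small enough that at most about half of the window is lost. *)
pose E := (n %/ (2 * M))%N; pose h := (n %/ (64 * M ^ 2))%N.
pose big := [set a in A | (n <= 4 * M * a)%N].
have M2 : (0 < M ^ 2)%N by rewrite expn_gt0 M0.
have Elo : (E * (2 * M) <= n)%N by apply: leq_trunc_div.
have Ehi : (n < E.+1 * (2 * M))%N by rewrite ltn_ceil //; lia.
have hlo : (h * (64 * M ^ 2) <= n)%N by apply: leq_trunc_div.
have hhi : (n < h.+1 * (64 * M ^ 2))%N by rewrite ltn_ceil //; lia.
have h0 : (0 < h)%N by rewrite divn_gt0 //; lia.
(* Rounding down at most halves [n / (64 * M ^ 2)], because [h >= 1]; hence 128. *)
have hsep : (n <= 128 * M ^ 2 * h)%N.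
  move: (M ^ 2)%N hhi h0 => m; nia.
have n0 : (0 < n)%N by lia.
have cbig : (#|big| <= 4 * M)%N by apply: card_large.
have Ep : (2 * E <= p')%N.
  by rewrite -(leq_pmul2l M0); lia.
pose range := [set v : 'I_n | p' - E <= v < p']%N.
have crange : (E <= #|range|)%N.
  by apply: leq_trans (card_ord_interval_ge _ p'n); lia.
(* The [v] for which [v] itself, respectively the partner [p + p' - v], is at distance less than [h]
   from [a]. *)
pose near a := [set v : 'I_n | (a + 1) - h <= v < a + h]%N :|:
               [set v : 'I_n | (p + p' + 1) - (a + h) <= v < p + p' + h - a]%N.
have cnear (a : nat) : (#|near a| <= 4 * h)%N.
  apply: leq_trans (leq_card_setU _ _) _.
  have := card_ord_interval (a + 1 - h) (a + h).
  have := card_ord_interval (p + p' + 1 - (a + h)) (p + p' + h - a).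
  by clear; lia.
have sub : range \subset good :|: \bigcup_(a in big) near a.
  apply/fintype.subsetP => v; rewrite !inE => /andP[vlo vhi].
  have [//|ngood] := boolP (v \in good); first by rewrite inE => ->.
  apply/orP; right; apply: contraNT ngood => nnear; rewrite inE.
  have far a : a \in A -> (n <= 4 * M * a)%N -> v \notin near a.
    move=> aA na; apply: contraNN nnear => vn; apply/finset.bigcupP; exists a => //.
    by rewrite inE aA.
  rewrite vhi (_ : (p' <= 2 * v)%N) /=; last lia.
  apply/andP; split; apply/well_separatedP => a aA na; apply: (leq_trans hsep);
    rewrite leq_mul2l; apply/orP; right; have := far a aA na; rewrite !inE;
    move: (nat_of_ord a) (nat_of_ord v) vhi; clear; lia.
have c1 : (E <= #|good| + 16 * M * h)%N.
  apply: (leq_trans crange); apply: leq_trans (subset_leq_card sub) _.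
  apply: leq_trans (leq_card_setU _ _) _; rewrite leq_add2l.
  apply: leq_trans (card_bigcup_leq _ _) _.
  apply: (@leq_trans (\sum_(a in big) 4 * h)); first by apply: leq_sum => a _.
  rewrite sum_nat_const; move: #|big| cbig => k; nia.
have c2 : (4 * M * (16 * M * h) <= n)%N by move: hlo; rewrite expnS expn1; nia.
have c3 : (8 * M <= n)%N by move: nM; rewrite expnS expn1; nia.
(* Here [8 * M * E > 4 * n - 8 * M] and [8 * M * k <= 2 * n], so
   [8 * M * g > 2 * n - 8 * M >= n]. *)
move: c1 c2 c3 Ehi M0; move: (16 * M * h)%N #|good| => k g.
nia.
Qed.

End Counting.

(** * Comparison of the weights before and after a move *)

Section Comparison.
Variables (R : realType) (n M : nat).
Hypotheses (M_gt0 : (0 < M)%N) (n_gt0 : (0 < n)%N).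
Implicit Types (A P Q : {set 'I_n}).

Let L : R := (128 * M ^ 2)%:R.

(** The exponential of [M] comes from the upper bound at [x >= n / M], the other term of the
    exponent from the lower bound at [y >= n / (2 * M)], and 4 from [y <= 2 * x] in the ratio of the
    inverse squares. *)
Definition move_const : R := 4 * expR (M%:R + (2 * L + 1) * (2 * M%:R)).

(** The upper bound on [interaction] holds at any [x], so separation is asked of the new position
    [y] only. *)
Lemma interaction_compare A Q (x y : nat) :
  (y <= n)%N -> (y <= 2 * x)%N -> (n <= M * x)%N -> (n <= 2 * M * y)%N ->
  (\sum_(a in A) a <= n)%N -> (\sum_(b in Q) (b + 1) <= n)%N ->
  #|Q| = (#|A| + 2)%N -> well_separated M A y ->
  interaction R A Q x <= move_const * interaction R A Q y.
Proof.
move=> yn yx nx ny sA sQ cQ /well_separatedP sep.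
have x0 : (0 < x)%N by nia.
have y0 : (0 < y)%N by nia.
have xR : 0 < x%:R :> R by rewrite ltr0n.
have yR : 0 < y%:R :> R by rewrite ltr0n.
have M2 : (0 < M ^ 2)%N by rewrite expn_gt0 M_gt0.
have L1 : 1 <= L by rewrite /L ler1n; lia.
have low : expR (- ((2 * L + 1) * (n%:R / y%:R))) / y%:R ^+ 2 <= interaction R A Q y.
  apply: interaction_ge => // a aA ya.
  have na : (n <= 4 * M * a)%N by nia.
  have Dist : `|y%:R - a%:R| = ((y - a) + (a - y))%:R :> R.
    have [ya'|ay] := leqP y a.
      by rewrite distrC ger0_norm ?subr_ge0 ?ler_nat // -natrB //; congr _%:R; lia.
    rewrite ger0_norm ?subr_ge0 ?ler_nat 1?ltnW // -natrB 1?ltnW //.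
    by congr _%:R; lia.
  (* Separation gives [y <= n <= L * distance], and [L <= expR L]. *)
  rewrite Dist expRN ler_pdivrMr ?expR_gt0 //.
  apply: (@le_trans _ _ (L * ((y - a) + (a - y))%:R)).
    by rewrite /L -natrM ler_nat (leq_trans yn) ?sep.
  rewrite [leRHS]mulrC ler_wpM2r //; apply: le_trans (expR_ge1Dx _); lra.
have up := interaction_le R x0 sA cQ.
have nxM : n%:R / x%:R <= M%:R :> R by rewrite ler_pdivrMr // -natrM ler_nat.
have nyM : n%:R / y%:R <= 2 * M%:R :> R by rewrite ler_pdivrMr // -!natrM ler_nat.
have low2 : expR (- ((2 * L + 1) * (2 * M%:R))) / y%:R ^+ 2 <= interaction R A Q y.
  apply: le_trans low; rewrite ler_pM2r ?invr_gt0 ?exprn_gt0 // ler_expR lerN2.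
  by rewrite ler_pM2l //; lra.
apply: (@le_trans _ _ (move_const * (expR (- ((2 * L + 1) * (2 * M%:R))) / y%:R ^+ 2)));
  last by rewrite ler_pM2l // mulr_gt0 ?expR_gt0.
rewrite /move_const expRD expRN.
have e0 : expR ((2 * L + 1) * (2 * M%:R)) != 0 :> R by rewrite gt_eqF ?expR_gt0.
rewrite (_ : 4 * _ * _ = expR M%:R * (4 / y%:R ^+ 2)); last first.
  by field; rewrite e0 gt_eqF.
apply: (le_trans up); apply: ler_pM; rewrite ?expR_ge0 ?invr_ge0 ?exprn_ge0 ?ler_expR //.
rewrite ler_pdivlMr ?exprn_gt0 // mulrC ler_pdivrMr ?exprn_gt0 //.
by rewrite -!natrX -natrM ler_nat; nia.
Qed.

Variables (w w' : nat -> R) (C : R).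
Hypotheses (w_gt0 : forall k, 0 < w k) (w'_gt0 : forall k, 0 < w' k).
Hypothesis C_ge0 : 0 <= C.
Hypothesis w_regular : forall x y, (x <= n)%N -> (y <= n)%N ->
  (n <= 2 * M * x)%N -> (n <= 2 * M * y)%N -> w x <= C * w y.

(** Each of the two elements costs one [C] and, through the squared interaction, two factors
    [move_const]. Their mutual gap only grows, since [v < p' < p < u]. *)
Lemma frob_weight_move A Q (p p' u v : 'I_n) :
  p \notin A -> p' \notin A -> u \notin A -> v \notin A ->
  (p' < p)%N -> (v < p')%N -> (u + v = p + p')%N -> (n <= M * p')%N -> (p' <= 2 * v)%N ->
  (\sum_(a in A) a <= n)%N -> (\sum_(b in Q) (b + 1) <= n)%N ->
  #|Q| = (#|A| + 2)%N -> well_separated M A u -> well_separated M A v ->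
  frob_weight w w' (p |: (p' |: A)) Q <=
  (C ^+ 2 * move_const ^+ 4) * frob_weight w w' (u |: (v |: A)) Q.
Proof.
move=> pA p'A uA vA p'p vp' uv np' p'v sA sQ cQ su sv.
have np : (n <= M * p)%N by rewrite (leq_trans np') // leq_mul2l (ltnW p'p) orbT.
have nv : (n <= 2 * M * v)%N.
  by rewrite (leq_trans np') // mulnAC mulnC leq_mul2r p'v orbT.
have vu : (v < u)%N by move: p'p vp' uv; clear; lia.
have nu : (n <= 2 * M * u)%N by rewrite (leq_trans nv) // leq_mul2l (ltnW vu) orbT.
have np2 (x : nat) : (n <= M * x)%N -> (n <= 2 * M * x)%N.
  by move=> nx; rewrite (leq_trans nx) // -mulnA leq_pmull.
have up : (u <= 2 * p)%N by move: p'p uv; clear; lia.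
have vp : (v <= 2 * p')%N by move: vp'; clear; lia.
have lt_le (x : 'I_n) : (x <= n)%N by apply: ltnW.
have Ip := interaction_compare (lt_le u) up np nu sA sQ cQ su.
have Ip' := interaction_compare (lt_le v) vp np' nv sA sQ cQ sv.
have wp : w p <= C * w u by apply: w_regular; rewrite // np2.
have wp' : w p' <= C * w v by apply: w_regular; rewrite // np2.
have pA' : p \notin p' |: A by rewrite !inE negb_or pA -val_eqE /= gtn_eqF.
have uA' : u \notin v |: A by rewrite !inE negb_or uA -val_eqE /= gtn_eqF.
rewrite !frob_weight_setU1 //.
rewrite !interaction_setU1 //.
have gap : `|p%:R - p'%:R| <= `|u%:R - v%:R| :> R.
  rewrite !ger0_norm ?subr_ge0 ?ler_nat ?(ltnW p'p) ?(ltnW vu) //.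
  rewrite -!natrB ?(ltnW p'p) ?(ltnW vu) // ler_nat.
  by move: p'p vp' uv; clear; lia.
have F0 : 0 <= frob_weight w w' A Q by apply: frob_weight_ge0.
have K0 : 0 <= move_const by rewrite mulr_ge0 ?expR_ge0.
set F := frob_weight _ _ _ _ in F0 *.
rewrite [leRHS](_ : _ = F * ((C * w v) * (move_const * interaction R A Q v) ^+ 2) *
  ((C * w u) * (`|u%:R - v%:R| * (move_const * interaction R A Q u)) ^+ 2)); last by ring.
have sq_le (a b : R) : 0 <= a -> a <= b -> a ^+ 2 <= b ^+ 2.
  by move=> a0 ab; rewrite lerXn2r ?nnegrE // (le_trans a0).
have w0 k : 0 <= w k by apply: ltW.
have I0 x : 0 <= interaction R A Q x by apply: interaction_ge0.
have term_le a a' b b' : 0 <= a -> 0 <= b -> a <= a' -> b <= b' ->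
    a * b ^+ 2 <= a' * b' ^+ 2 :> R.
  by move=> a0 b0 aa' bb'; apply: ler_pM; rewrite ?sqr_ge0 ?sq_le.
have ww0 k x : 0 <= w k * x ^+ 2 by rewrite mulr_ge0 ?sqr_ge0.
apply: ler_pM; [exact: mulr_ge0 | exact: ww0 | |].
  by apply: ler_wpM2l => //; apply: term_le.
by apply: term_le => //; [exact: mulr_ge0 | apply: ler_pM].
Qed.
End Comparison.

(** * The mass of the configurations with a close pair *)

Section Repulsion.
Variables (R : realType) (n M : nat).
Hypotheses (M_gt0 : (0 < M)%N) (n_large : (64 * M ^ 2 <= n)%N).
Variables (kappa : nat -> R) (w w' : nat -> R) (C : R).
Hypotheses (kappa_ge0 : forall k, 0 <= kappa k).
Hypotheses (w_gt0 : forall k, 0 < w k) (w'_gt0 : forall k, 0 < w' k).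
Hypothesis C_ge0 : 0 <= C.
Hypothesis w_regular : forall x y, (x <= n)%N -> (y <= n)%N ->
  (n <= 2 * M * x)%N -> (n <= 2 * M * y)%N -> w x <= C * w y.

Notation config := ({set 'I_n} * {set 'I_n})%type.
Notation quad := ('I_n * 'I_n * ('I_n * 'I_n))%type.

Definition close_pair (J : nat) (P : {set 'I_n}) : bool :=
  [exists p in P, exists p' in P,
     [&& p' < p, J * (p - p') < n & n <= M * p']]%N.

(** A move is coded by [((p, p'), (u, v))]: [p] and [p'] are taken out of the first set and [u] and
    [v] put in. *)
Let rest (s : config) (i : quad) := s.1 :\ i.1.1 :\ i.1.2.

Let good (J : nat) (s : config) (i : quad) : bool :=
  [&& [&& i.1.1 \in s.1, i.1.2 \in s.1, i.1.2 < i.1.1,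
          J * (i.1.1 - i.1.2) < n & n <= M * i.1.2],
      [&& i.2.2 < i.1.2, i.1.2 <= 2 * i.2.2 & i.2.1 + i.2.2 == i.1.1 + i.1.2],
      well_separated M (rest s i) i.2.1 & well_separated M (rest s i) i.2.2]%N.

Let move (s : config) (i : quad) : config :=
  (i.2.1 |: (i.2.2 |: rest s i), s.2).

Let n_gt0 : (0 < n)%N.
Proof.
have : (0 < M ^ 2)%N by rewrite expn_gt0 M_gt0.
by move: n_large; lia.
Qed.

(** An element of [A] of this size would have to be at positive distance from itself. *)
Lemma well_separated_notin A (x : 'I_n) :
  (n <= 4 * M * x)%N -> well_separated M A x -> x \notin A.
Proof.
move=> nx /well_separatedP sep; apply/negP => xA.
by have := sep x xA nx; rewrite subnn muln0 leqNgt n_gt0.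
Qed.

Lemma setD1_split (P : {set 'I_n}) (p p' : 'I_n) :
  p \in P -> p' \in P -> (p' < p)%N ->
  let A := P :\ p :\ p' in
  [/\ P = p |: (p' |: A), p \notin A, p' \notin A,
      (\sum_(x in P) x = p + p' + \sum_(a in A) a)%N & #|P| = (#|A| + 2)%N].
Proof.
move=> pP p'P p'p A.
have p'D : p' \in P :\ p by rewrite !inE p'P -val_eqE /= ltn_eqF.
have PE : P = p |: (p' |: A) by rewrite /A !finset.setD1K.
split => //; rewrite /A ?inE ?eqxx ?andbF //.
  by rewrite (big_setD1 p) //= (big_setD1 p') //= addnA.
by rewrite (cardsD1 p) pP (cardsD1 p' (P :\ p)) p'D addnA addnC.
Qed.

(** Since [u + v = p + p'] and the cardinality is kept, the image is again an admissible pair for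
    the same [n]. *)
Lemma goodP J (s : config) (i : quad) : frob_ok s -> good J s i ->
  let A := rest s i in
  let: (p, p', (u, v)) := i in
  [/\ [/\ s.1 = p |: (p' |: A), p \notin A, p' \notin A, u \notin A & v \notin A],
      [/\ (p' < p)%N, (v < p')%N, (u + v = p + p')%N, (n <= M * p')%N & (p' <= 2 * v)%N],
      [/\ (\sum_(a in A) a <= n)%N, (\sum_(b in s.2) (b + 1) <= n)%N,
          #|s.2| = (#|A| + 2)%N, well_separated M A u & well_separated M A v],
      frob_ok (move s i) & #|s.1| = #|(move s i).1|] /\
  [/\ (J * (p - p') < n)%N, (n <= 2 * M * u)%N & (n <= 2 * M * v)%N].
Proof.
case: i => [[p p'] [u v]] oks.
move=> /and4P[/and5P[pP p'P p'p Jpp' np'] /and3P[vp' p'v /eqP uv] su sv] A.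
rewrite /= in pP p'P p'p Jpp' np' vp' p'v uv su sv.
rewrite (_ : move _ _ = (u |: (v |: A), s.2)) //.
have {su} su : well_separated M A u by [].
have {sv} sv : well_separated M A v by [].
have [PE pA p'A sP cP] : [/\ s.1 = p |: (p' |: A), p \notin A, p' \notin A,
    (\sum_(x in s.1) x = p + p' + \sum_(a in A) a)%N & #|s.1| = (#|A| + 2)%N].
  exact: setD1_split.
clearbody A.
have nv : (n <= 2 * M * v)%N.
  by rewrite (leq_trans np') // mulnAC mulnC leq_mul2r p'v orbT.
have vu : (v < u)%N by move: p'p vp' uv; clear; lia.
have nu : (n <= 2 * M * u)%N by rewrite (leq_trans nv) // leq_mul2l (ltnW vu) orbT.
have n4 (x : nat) : (n <= 2 * M * x)%N -> (n <= 4 * M * x)%N.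
  by move=> nx; rewrite (leq_trans nx) // leq_mul // leq_mul.
have uA : u \notin A by apply: well_separated_notin su; apply: n4.
have vA : v \notin A by apply: well_separated_notin sv; apply: n4.
have uvA : u \notin v |: A by rewrite in_setU1 negb_or uA -val_eqE /= gtn_eqF.
have /andP[/eqP cPQ /eqP ssum] := oks.
have cmv : #|u |: (v |: A)| = (#|A| + 2)%N by rewrite !cardsU1 uvA vA addnA addnC.
have ssum' : (p + p' + \sum_(a in A) a + \sum_(q in s.2) q + (#|A| + 2) = n)%N.
  by rewrite -sP -cP; exact: ssum.
split; split => //; [split => // | | by rewrite cmv].
- by move: ssum'; clear; lia.
- rewrite big_split /= sum1_card -cPQ cP.
  by rewrite -[leqRHS]ssum' leq_add2r leq_addl.
- by rewrite -cPQ.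
- rewrite /frob_ok /= cmv -cP cPQ eqxx /=; apply/eqP.
  rewrite !big_setU1 //= addnA [(_ + val _)%N]uv -cPQ cP.
  exact: ssum'.
Qed.

Let mass (s : config) : R := kappa #|s.1| * frob_weight w w' s.1 s.2.

(** Double counting with at least [n / (8 * M)] moves per configuration and at most
    [4 * M ^ 2 * (n / J + 1)] preimages; their ratio is at most [64 * M ^ 3 / J]. *)
Lemma close_pair_mass (J : nat) : (0 < J)%N -> (J <= n)%N ->
  \sum_(s : config | frob_ok s && close_pair J s.1) mass s <=
  64 * M%:R ^+ 3 * (C ^+ 2 * move_const R M ^+ 4) / J%:R *
    \sum_(s : config | frob_ok s) mass s.
Proof.
move=> J0 Jn.
have K0 : 0 <= C ^+ 2 * move_const R M ^+ 4.
  by rewrite mulr_ge0 ?exprn_ge0 // mulr_ge0 ?expR_ge0.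
have mass0 s : 0 <= mass s by rewrite mulr_ge0 ?frob_weight_ge0.
have MR : 0 < M%:R :> R by rewrite ltr0n.
have nR : 0 < n%:R :> R by rewrite ltr0n.
have JR : 0 < J%:R :> R by rewrite ltr0n.
have := @double_counting R config quad mass (@frob_ok n)
  (fun s => frob_ok s && close_pair J s.1) (good J) move
  (n%:R / (8 * M%:R)) ((2 * M) ^ 2 * (n %/ J).+1)%N _ K0.
have H1 : forall s : config, frob_ok s -> 0 <= mass s by [].
have H2 : forall s : config, frob_ok s && close_pair J s.1 -> frob_ok s.
  by move=> s /andP[].
have H3 : forall s : config, frob_ok s && close_pair J s.1 ->
    n%:R / (8 * M%:R) <= #|[set i | good J s i]|%:R :> R.
  move=> s /andP[oks /exists_inP[p pP /exists_inP[p' p'P /and3P[p'p Jpp' np']]]].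
  have [PE pA p'A sP cP] := setD1_split pP p'P p'p.
  have /andP[_ /eqP ssum] := oks.
  have ppn : (p + p' + 2 <= n)%N.
    have : (p + p' <= \sum_(x in s.1) x)%N by rewrite sP leq_addr.
    have : (2 <= #|s.1|)%N by rewrite cP addn2.
    move: ssum; rewrite -[X in X = _]/(\sum_(x in s.1) x + \sum_(x in s.2) x + #|s.1|)%N.
    by clear; lia.
  have sA : (\sum_(a in s.1 :\ p :\ p') a <= n)%N.
    apply: (@leq_trans (\sum_(x in s.1) x)); first by rewrite sP leq_addl.
    rewrite -[leqRHS]ssum -addnA; exact: leq_addr.
  have p'n : (p' <= n)%N by apply: ltnW.
  have many := many_well_separated p M_gt0 n_large sA np' p'n.
  rewrite ler_pdivrMr ?mulr_gt0 // -!natrM ler_nat.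
  apply: (leq_trans many); rewrite mulnC leq_mul2r; apply/orP; right.
  (* The default [p] of [insubd] never occurs, because [p + p' < n] by [ppn]. *)
  pose f (v : 'I_n) : quad := (p, p', (insubd p (p + p' - v)%N, v)).
  have f_inj : injective f by move=> v1 v2 [].
  rewrite -(card_imset _ f_inj); apply: subset_leq_card.
  apply/fintype.subsetP => i /imsetP[v]; rewrite inE => /and4P[vp' p'v sv su] ->.
  have uE : val (insubd p (p + p' - v)%N) = (p + p' - v)%N.
    by rewrite val_insubd ifT //; move: ppn; clear; lia.
  rewrite inE /good /f /rest /= pP p'P p'p Jpp' np' vp' p'v sv andbT /=.
  rewrite -[X in well_separated M _ X]/(val (insubd p (p + p' - v)%N)) uE su andbT.
  rewrite -[X in (X + v)%N]/(val (insubd p (p + p' - v)%N)) uE.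
  by apply/eqP; move: vp'; clear; lia.
have H4 : forall (s : config) i, frob_ok s && close_pair J s.1 -> good J s i ->
    frob_ok (move s i) /\
    mass s <= C ^+ 2 * move_const R M ^+ 4 * mass (move s i).
  move=> s [[p p'] [u v]] /andP[oks _] gi.
  have [[[PE pA p'A uA vA] [p'p vp' uv np' p'v] [sA sQ cQ su sv] okm cm] _] := goodP oks gi.
  split=> //; rewrite /mass -cm [leRHS]mulrCA; apply: ler_wpM2l => //.
  by rewrite {1}PE; apply: frob_weight_move.
have H5 : forall t : config, frob_ok t ->
    (#|[set x : config * quad | (frob_ok x.1 && close_pair J x.1.1) &&
        good J x.1 x.2 && (move x.1 x.2 == t)]| <= (2 * M) ^ 2 * (n %/ J).+1)%N.
  move=> t okt; set X := [set x | _].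
  pose B := [set a in t.1 | n <= 2 * M * a]%N.
  have cB : (#|B| <= 2 * M)%N.
    apply: card_large => //.
    have /andP[_ /eqP ssum] := okt; rewrite -[leqRHS]ssum -addnA; exact: leq_addr.
  (* The sum [p + p' = u + v] is known from [u] and [v], so the difference [p - p'] fixes both, and
     then the preimage. The difference is at most [n / J], so [inord] does not truncate it. *)
  pose f (x : config * quad) : 'I_n * 'I_n * 'I_(n %/ J).+1 :=
    (x.2.2.1, x.2.2.2, inord (x.2.1.1 - x.2.1.2)).
  have XP s p p' u v : (s, (p, p', (u, v))) \in X ->
    [/\ [/\ u \in t.1, v \in t.1, (n <= 2 * M * u)%N & (n <= 2 * M * v)%N],
        [/\ (p' < p)%N, (u + v = p + p')%N & (p - p' < (n %/ J).+1)%N],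
        s.1 = p |: (p' |: (t.1 :\ u :\ v)) & s.2 = t.2].
    rewrite inE /= => /andP[/andP[/andP[oks _] gi] /eqP mt].
    have [[[PE pA p'A uA vA] [p'p vp' uv np' p'v] _ _ _] [Jpp' nu nv]] := goodP oks gi.
    have uv' : u != v by rewrite -val_eqE /=; move: p'p vp' uv; clear; lia.
    rewrite -mt /move /=; split => //; first by rewrite !inE !eqxx orbT.
      by split => //; rewrite ltnS leq_divRL // mulnC ltnW.
    rewrite {1}PE; congr (_ |: (_ |: _)); rewrite finset.setU1K ?finset.setU1K //.
    by rewrite in_setU1 negb_or uv' uA.
  have f_inj : {in X &, injective f}.
    move=> [s1 [[p1 p1'] [u1 v1]]] [s2 [[p2 p2'] [u2 v2]]]
      /XP[_ [a1 b1 c1] d1 e1] /XP[_ [a2 b2 c2] d2 e2].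
    move=> [ue ve /(congr1 (@nat_of_ord _))]; rewrite !inordK // => de; subst u2 v2.
    have pe : p1 = p2 by apply: val_inj; move: a1 b1 a2 b2 de => /=; clear; lia.
    have pe' : p1' = p2' by apply: val_inj; move: a1 b1 a2 b2 de => /=; clear; lia.
    subst p2 p2'; congr (_, _).
    by rewrite [s1]surjective_pairing [s2]surjective_pairing d1 d2 e1 e2.
  rewrite -(card_in_imset f_inj).
  apply: (@leq_trans #|finset.setX (finset.setX B B) [set: 'I_(n %/ J).+1]|).
    apply: subset_leq_card; apply/fintype.subsetP => y
      /imsetP[[s [[p p'] [u v]]] /XP[[ut vt nu nv] _ _ _] ->].
    by rewrite !inE /= ut vt nu nv.
  by rewrite !cardsX cardsT card_ord leq_mul2r leq_mul ?orbT.
move=> /(_ H1 H2 H3 H4 H5).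
set Sb := \sum_(s | _) mass s; set So := \sum_(s | _) mass s.
have So0 : 0 <= So by apply: sumr_ge0.
set K := C ^+ 2 * _ in K0 *.
move=> main.
(* [J <= n] absorbs the successor: [n / J + 1 <= 2 * n / J]. *)
have mle : ((2 * M) ^ 2 * (n %/ J).+1)%:R <= 8 * M%:R ^+ 2 * (n%:R / J%:R) :> R.
  rewrite natrM natrX natrM exprMn.
  rewrite (_ : 8 * _ * _ = (2%:R ^+ 2 * M%:R ^+ 2) * (2 * (n%:R / J%:R))); last by ring.
  rewrite ler_wpM2l ?mulr_ge0 ?exprn_ge0 // mulrA ler_pdivlMr // -!natrM ler_nat.
  have := leq_trunc_div n J; rewrite mulSn; move: Jn; clear; lia.
rewrite -(ler_pM2l (_ : 0 < n%:R / (8 * M%:R))); last by rewrite divr_gt0 ?mulr_gt0.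
apply: (le_trans main).
rewrite (_ : _ / _ * _ = K * (8 * M%:R ^+ 2 * (n%:R / J%:R)) * So); last first.
  by field; rewrite !gt_eqF.
by rewrite ler_wpM2r // ler_wpM2l.
Qed.

End Repulsion.

(** * Slow variation of the Pochhammer weights *)

Section Weights.
Variable R : realType.

(** Each of the [j] steps costs at most a factor [1 + c / x <= expR (c / x)]. *)
Lemma slow_growth (g : nat -> R) (c : R) (k0 x j : nat) :
  (0 < x)%N -> (k0 <= x)%N -> 0 <= c -> (forall k, 0 < g k) ->
  (forall k, (k0 <= k)%N -> g k.+1 <= g k * (1 + c / k.+1%:R)) ->
  g (x + j)%N <= g x * expR (j%:R * (c / x%:R)).
Proof.
move=> x0 k0x c0 gpos grow; elim: j => [|j IH].
  by rewrite addn0 mul0r expR0 mulr1.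
rewrite addnS; apply: le_trans (grow _ (leq_trans k0x (leq_addr _ _))) _.
rewrite -[j.+1%:R]natr1 mulrDl mul1r expRD mulrA; apply: ler_pM => //.
- exact: ltW.
- by rewrite addr_ge0 // divr_ge0.
- apply: le_trans (expR_ge1Dx _) _; rewrite ler_expR ler_wpM2l // lef_pV2 ?posrE ?ltr0n //.
  by rewrite ler_nat leqW ?leq_addr.
Qed.

Definition slowly_varying (w : nat -> R) : Prop :=
  forall M : nat, (0 < M)%N -> exists C : R, exists N : nat, 0 <= C /\
  forall n, (N <= n)%N -> forall x y, (x <= n)%N -> (y <= n)%N ->
    (n <= 2 * M * x)%N -> (n <= 2 * M * y)%N -> w x <= C * w y.

(** With [s = z + z'] and [t = z * z'] this is [(z + 1)_k (z' + 1)_k / k!^2], with the conjugate or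
    real factors paired into real quadratics. The weight of the [q] is obtained from [- s]. *)
Definition pweight (s t : R) (k : nat) : R :=
  (\prod_(i < k) (i.+1%:R ^+ 2 + s * i.+1%:R + t)) / k`!%:R ^+ 2.

Variables (s t : R).
Hypothesis quad_gt0 : forall i : nat, 0 < i.+1%:R ^+ 2 + s * i.+1%:R + t.

Lemma pweight_gt0 k : 0 < pweight s t k.
Proof.
rewrite divr_gt0 ?exprn_gt0 ?ltr0n ?fact_gt0 //.
by apply: prodr_gt0.
Qed.

Lemma pweightS k : pweight s t k.+1 =
  pweight s t k * ((k.+1%:R ^+ 2 + s * k.+1%:R + t) / k.+1%:R ^+ 2).
Proof.
rewrite /pweight big_ord_recr /= factS natrM exprMn invfM; ring.
Qed.

(** The ratio of consecutive values is [1 + O(1 / k)], so [slow_growth] applies to the weight and to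
    its inverse; at most [n] steps from [x >= n / (2 * M)] cost [expR (2 * M * c)]. *)
Lemma pweight_slowly_varying : slowly_varying (pweight s t).
Proof.
(* The factor 2 in [c] serves [down]: [(a + c) * (a - c / 2) >= a ^ 2] as soon as [a >= c]. *)
move=> M M0; set w := pweight s t; set c := 2 * (`|s| + `|t|).
have s0 := normr_ge0 s; have t0 := normr_ge0 t.
have c0 : 0 <= c by rewrite /c; lra.
pose k0 := Num.truncn c.
have k0P k : (k0 <= k)%N -> c <= k.+1%:R.
  move=> kk; apply: ltW; apply: lt_le_trans (truncnS_gt _) _.
  by rewrite ler_nat ltnS.
have up k : (k0 <= k)%N -> w k.+1 <= w k * (1 + c / k.+1%:R).
  move=> kk; rewrite /w pweightS ler_pM2l ?pweight_gt0 //.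
  have a1 : 1 <= k.+1%:R :> R by rewrite ler1n.
  set a := k.+1%:R in a1 *; have a0 : 0 < a by lra.
  rewrite ler_pdivrMr ?exprn_gt0 //.
  rewrite [leRHS](_ : _ = a ^+ 2 + c * a); last by field; rewrite gt_eqF.
  have := ler_norm s; have := ler_norm t; rewrite /c; nra.
have down k : (k0 <= k)%N -> (w k.+1)^-1 <= (w k)^-1 * (1 + c / k.+1%:R).
  move=> kk; rewrite /w pweightS invfM ler_pM2l ?invr_gt0 ?pweight_gt0 //.
  have := quad_gt0 k; have := k0P k kk.
  have a1 : 1 <= k.+1%:R :> R by rewrite ler1n.
  set a := k.+1%:R in a1 *; have a0 : 0 < a by lra.
  move=> ca q0; rewrite invf_div ler_pdivrMr //.
  rewrite -(ler_pM2r a0).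
  rewrite [leRHS](_ : _ = (a + c) * (a ^+ 2 + s * a + t)); last first.
    by field; rewrite gt_eqF.
  have q1 : a * (a - c / 2) <= a ^+ 2 + s * a + t.
    have := ler_norm (- s); have := ler_norm (- t); rewrite !normrN /c; nra.
  apply: (@le_trans _ _ ((a + c) * (a * (a - c / 2)))); last first.
    by rewrite ler_pM2l //; lra.
  rewrite -subr_ge0 [leRHS](_ : _ = a * (c / 2 * (a - c))); last by field.
  by rewrite !mulr_ge0 ?subr_ge0 //; lra.
exists (expR (2 * M%:R * c)), (2 * M * k0.+1)%N; split; first exact: expR_ge0.
move=> n Nn.
have pos k : (n <= 2 * M * k)%N -> (k0 < k)%N.
  by move=> nk; rewrite -(leq_pmul2l (_ : 0 < 2 * M)%N) ?muln_gt0 // (leq_trans Nn).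
have bnd x j : (n <= 2 * M * x)%N -> (x + j <= n)%N ->
    expR (j%:R * (c / x%:R)) <= expR (2 * M%:R * c).
  move=> nx jn; have x0 : 0 < x%:R :> R by rewrite ltr0n (leq_ltn_trans _ (pos _ nx)).
  rewrite ler_expR mulrA ler_pdivrMr // mulrAC ler_wpM2r // -!natrM ler_nat.
  by rewrite (leq_trans _ nx) // (leq_trans _ jn) ?leq_addl.
have w0 k : 0 < w k by apply: pweight_gt0.
have wV0 k : 0 < (w k)^-1 by rewrite invr_gt0.
move=> x y xn yn nx ny; have [yx|/ltnW xy] := leqP y x.
  rewrite -(subnKC yx) mulrC.
  apply: le_trans (slow_growth _ _ (ltnW (pos _ ny)) c0 w0 up) _.
    exact: leq_ltn_trans (pos _ ny).
  by rewrite ler_wpM2l ?bnd ?subnKC // ltW.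
have := slow_growth (y - x) (leq_ltn_trans (leq0n _) (pos _ nx)) (ltnW (pos _ nx)) c0 wV0 down.
rewrite subnKC // -[(w y)^-1]mul1r ler_pdivrMr // => H.
rewrite -mulrA ler_pdivlMl // mulr1 in H.
by apply: (le_trans H); rewrite ler_wpM2r ?bnd ?subnKC // ltW.
Qed.

End Weights.

(** * The mass as a real weight *)

Section MassFormula.
Variable R : realType.

(** The quadratic is [(z + a) * (z' + a)]: a nonzero squared modulus in the conjugate case, a
    product of two reals of equal sign in the other. Positive, zero and negative [a] serve the [p],
    [t] and the [q]. *)
Lemma admissible_quad (z z' : R[i]) : admissible z z' ->
  exists s t : R, [/\ z + z' = s%:C%C, z * z' = t%:C%C &
    forall a : int, 0 < (a%:~R) ^+ 2 + s * a%:~R + t].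
Proof.
case=> [[-> zint]|].
  case: z zint => x y zint; exists (x + x), (x ^+ 2 + y ^+ 2); split.
  - by apply/eqP; rewrite eq_complex /= subrr !eqxx.
  - by apply/eqP; rewrite eq_complex /= mulrN opprK -!expr2 eqxx /= mulrN mulrC addNr.
  move=> a.
  rewrite [ltRHS](_ : _ = (x + a%:~R) ^+ 2 + y ^+ 2); last by ring.
  rewrite lt_neqAle addr_ge0 ?sqr_ge0 // andbT eq_sym paddr_eq0 ?sqr_ge0 //.
  rewrite !sqrf_eq0; apply/negP => /andP[/eqP xa /eqP y0].
  have /negP := zint (- a); apply; apply/eqP.
  rewrite -(rmorph_int (real_complex R)) y0 rmorphN /=.
  by congr (_ +i* _)%C; lra.
case: z => x y; case: z' => x' y' /= [-> [-> [m [/andP[mx xm] /andP[mx' xm']]]]].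
exists (x + x'), (x * x'); split.
- by apply/eqP; rewrite eq_complex /= addr0 !eqxx.
- by apply/eqP; rewrite eq_complex /= !mulr0 mul0r subr0 addr0 !eqxx.
move=> a; rewrite [ltRHS](_ : _ = (x + a%:~R) * (x' + a%:~R)); last by ring.
have [ma|ma] := leP 0 (m + a).
  have : 0 <= (m + a)%:~R :> R by rewrite ler0z.
  by rewrite intrD => ?; apply: mulr_gt0; lra.
have : (m + a + 1)%:~R <= 0 :> R by rewrite lerz0; lia.
by rewrite intrD in xm xm' *; rewrite !intrD => ?; rewrite nmulr_rgt0; lra.
Qed.

Variable n : nat.
Implicit Types A P Q : {set 'I_n}.

Lemma perm_dec_list A : perm_eq (dec_list A) [seq val x | x <- enum A].
Proof. by rewrite perm_sort. Qed.

Lemma size_dec_list A : size (dec_list A) = #|A|.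
Proof. by rewrite size_sort size_map -cardE. Qed.

Lemma uniq_dec_list A : uniq (dec_list A).
Proof. by rewrite sort_uniq map_inj_uniq ?enum_uniq //; exact: val_inj. Qed.

Lemma prod_dec_list (d : nat) A (F : nat -> R) : d = size (dec_list A) ->
  \prod_(i < d) F (nth 0%N (dec_list A) i) = \prod_(a in A) F a.
Proof.
move=> ->; rewrite -(big_mkord predT (fun i => F (nth 0%N (dec_list A) i))).
rewrite -(big_nth 0%N predT) (perm_big _ (perm_dec_list A)) big_map.
by rewrite big_enum.
Qed.

Lemma prod_dec_list_neq (d : nat) A (F : nat -> nat -> R) : d = size (dec_list A) ->
  \prod_(i < d) \prod_(j < d | j != i)
     F (nth 0%N (dec_list A) i) (nth 0%N (dec_list A) j) =
  \prod_(a in A) \prod_(b in A | b != a) F a b.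
Proof.
move=> dE; rewrite -(prod_dec_list (fun a => \prod_(b in A | val b != a) F a b) dE).
apply: eq_bigr => i _.
transitivity (\prod_(y <- dec_list A | y != nth 0%N (dec_list A) i)
                F (nth 0%N (dec_list A) i) y).
  rewrite (big_nth 0%N) big_mkord -dE; apply: eq_bigl => j.
  by rewrite nth_uniq ?uniq_dec_list // -dE.
by rewrite (perm_big _ (perm_dec_list A)) big_map big_enum_cond.
Qed.

Variable phi : {rmorphism R -> R[i]}.

Lemma poch_pair (z z' : R[i]) (s t : R) (k : nat) :
  z + z' = phi s -> z * z' = phi t ->
  poch (z + 1) k * poch (z' + 1) k =
  phi (\prod_(i < k) (i.+1%:R ^+ 2 + s * i.+1%:R + t)).
Proof.
move=> sE tE; rewrite /poch -big_split rmorph_prod; apply: eq_bigr => i _ /=.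
rewrite !rmorphD rmorphXn rmorphM rmorph_nat -sE -tE -natr1; ring.
Qed.

Hypothesis phiK : forall x, complex.Re (phi x) = x.

(** [phi] stands for the embedding of the reals: the whole expression is in its image, so taking the
    real part loses nothing. *)
Lemma frob_mass_weight (z z' : R[i]) (s t : R) (PQ : {set 'I_n} * {set 'I_n}) :
  z + z' = phi s -> z * z' = phi t -> frob_ok PQ ->
  frob_mass z z' PQ =
  (n`!%:R * t ^+ #|PQ.1| / \prod_(i < n) (t + i%:R)) *
  frob_weight (pweight s t) (pweight (- s) t) PQ.1 PQ.2.
Proof.
case: PQ => P Q sE tE /andP[/eqP /= cPQ _]; rewrite /frob_mass /=.
set ps := dec_list P; set qs := dec_list Q; set d := size ps.
have dP : d = size (dec_list P) by [].
have dQ : d = size (dec_list Q) by rewrite /d /ps !size_dec_list.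
have sE' : - z + - z' = phi (- s) by rewrite -opprD sE rmorphN.
have tE' : - z * - z' = phi t by rewrite mulrNN tE.
(* The 1 of [p + q + 1] goes into [y]; it cancels in the differences of the [y]. *)
pose x (i : 'I_d) : R := (nth 0%N ps i)%:R.
pose y (i : 'I_d) : R := (nth 0%N qs i + 1)%:R.
have y_inj : injective y.
  move=> i j /eqP; rewrite eqr_nat eqn_add2r nth_uniq ?uniq_dec_list -?dQ //.
  by move/eqP/val_inj.
have xyE i j : x i + y j = (nth 0%N ps i + nth 0%N qs j + 1)%:R.
  by rewrite -natrD addnA.
have xy0 i j : x i + y j != 0 by rewrite xyE addn1 pnatr_eq0.
have -> : (\matrix_(i < d, j < d)
      ((nth 0%N ps i + nth 0%N qs j + 1)%:R)^-1 : 'M[R[i]]_d) =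
    map_mx phi (\matrix_(i, j) (x i + y j)^-1).
  by apply/matrixP => i j; rewrite !mxE fmorphV xyE rmorph_nat.
rewrite det_map_mx tE.
have -> : \prod_(i < d)
   (poch (z + 1) (nth 0%N ps i) * poch (z' + 1) (nth 0%N ps i) *
    poch (- z + 1) (nth 0%N qs i) * poch (- z' + 1) (nth 0%N qs i) /
    (((nth 0%N ps i)`! ^ 2)%:R * ((nth 0%N qs i)`! ^ 2)%:R)) =
   phi ((\prod_(p in P) pweight s t p) * (\prod_(q in Q) pweight (- s) t q)).
  rewrite -(prod_dec_list (pweight s t) dP) -(prod_dec_list (pweight (- s) t) dQ).
  rewrite -big_split rmorph_prod; apply: eq_bigr => i _ /=.
  rewrite (poch_pair _ sE tE) -[phi _ * _ * _]mulrA (poch_pair _ sE' tE').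
  rewrite /pweight !rmorphM !fmorphV !rmorphXn /= !rmorph_nat -!expr2 invfM.
  exact: mulrACA.
have -> : poch (phi t) n = phi (\prod_(i < n) (t + i%:R)).
  by rewrite rmorph_prod; apply: eq_bigr => i _; rewrite rmorphD rmorph_nat.
rewrite -[n`!%:R](rmorph_nat phi) -!rmorphXn -!fmorphV -!rmorphM phiK.
have cross0 : cross_prod R P Q ^+ 2 != 0.
  rewrite expf_neq0 //; apply/prodf_neq0 => a _; apply/prodf_neq0 => b _.
  by rewrite addn1 pnatr_eq0.
have detE : (\det (\matrix_(i, j) (x i + y j)^-1)) ^+ 2 *
    cross_prod R P Q ^+ 2 = gap_prod R P * gap_prod R Q.
  have -> : cross_prod R P Q = \prod_i \prod_j (x i + y j).
    rewrite /cross_prod.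
    rewrite -(prod_dec_list (fun a => \prod_(b in Q) (a + b + 1)%:R) dP).
    apply: eq_bigr => i _.
    rewrite -(prod_dec_list (fun b => (nth 0%N ps i + b + 1)%:R) dQ).
    by apply: eq_bigr => j _; rewrite xyE.
  rewrite sqr_det_cauchy // /gap_prod.
  rewrite -(prod_dec_list_neq (fun a b => `|a%:R - b%:R|) dP).
  rewrite -(prod_dec_list_neq (fun a b => `|a%:R - b%:R|) dQ).
  congr (_ * _); apply: eq_bigr => i _; apply: eq_bigr => j _.
  by rewrite /y !natrD opprD addrACA subrr addr0.
rewrite (canRL (mulfK cross0) detE) /frob_weight /d size_dec_list.
by rewrite !mulrA.
Qed.

End MassFormula.

(** * Close pairs among the [p] or among the [q] *)

Definition side (T : Type) (b : bool) (w : T * T) : T := if b then w.1 else w.2.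

Section CloseMass.
Variable R : realType.

Lemma frob_weight_swap (n : nat) (w w' : nat -> R) (P Q : {set 'I_n}) :
  frob_weight w w' P Q = frob_weight w' w Q P.
Proof.
rewrite /frob_weight (mulrC (gap_prod R P)); congr (_ * (_ / _ ^+ 2)).
  exact: mulrC.
rewrite /cross_prod exchange_big /=; apply: eq_bigr => q _; apply: eq_bigr => p _.
by rewrite (addnC p).
Qed.

Lemma frob_ok_swap (n : nat) (PQ : {set 'I_n} * {set 'I_n}) :
  frob_ok (PQ.2, PQ.1) = frob_ok PQ.
Proof.
rewrite /frob_ok /= eq_sym; case: eqP => //= ->.
by rewrite [X in (X + _)%N]addnC.
Qed.

(** [kappa] collects the factors that depend on [n] and the cardinality alone, which a move
    preserves. *)
Lemma frob_mass_kappa (z z' : R[i]) : admissible z z' ->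
  exists w w' : nat -> R, exists kappa : nat -> nat -> R,
  [/\ [/\ forall k, 0 < w k, forall k, 0 < w' k & forall n k, 0 <= kappa n k],
      slowly_varying w, slowly_varying w' &
      forall n (PQ : {set 'I_n} * {set 'I_n}), frob_ok PQ ->
        frob_mass z z' PQ = kappa n #|PQ.1| * frob_weight w w' PQ.1 PQ.2].
Proof.
move=> /admissible_quad[s [t [sE tE quad_gt0]]].
have t0 : 0 < t by have := quad_gt0 0; rewrite mulr0 expr0n /= !add0r.
have q1 (i : nat) : 0 < i.+1%:R ^+ 2 + s * i.+1%:R + t.
  exact: (quad_gt0 (Posz i.+1)).
have q2 (i : nat) : 0 < i.+1%:R ^+ 2 + - s * i.+1%:R + t.
  have := quad_gt0 (- Posz i.+1); rewrite rmorphN /= sqrrN mulrN -mulNr.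
  exact.
exists (pweight s t), (pweight (- s) t).
exists (fun n k => n`!%:R * t ^+ k / \prod_(i < n) (t + i%:R)); split.
- split; [exact: pweight_gt0 | exact: pweight_gt0 |].
  move=> n k; rewrite !mulr_ge0 ?invr_ge0 ?exprn_ge0 ?(ltW t0) //.
  by apply: prodr_ge0 => i _; rewrite addr_ge0 // ltW.
- exact: pweight_slowly_varying.
- exact: pweight_slowly_varying.
- move=> n PQ ok.
  exact: (@frob_mass_weight R n (real_complex R) _ z z' s t PQ sE tE ok).
Qed.

Lemma frob_mass_ge0 (z z' : R[i]) n (PQ : {set 'I_n} * {set 'I_n}) :
  admissible z z' -> frob_ok PQ -> 0 <= frob_mass z z' PQ.
Proof.
move=> /frob_mass_kappa[w [w' [kappa [[w0 w'0 k0] _ _ massE]]]] ok.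
by rewrite massE // mulr_ge0 // frob_weight_ge0.
Qed.

(** The second side reduces to the first by exchanging the two sets and [w] with [w']. [K] does not
    depend on [J], only the threshold on [n] does. The total mass stays on the right, to be bounded
    through the weak limit. *)
Lemma close_pair_frob_mass (z z' : R[i]) (b : bool) (M : nat) :
  admissible z z' -> (0 < M)%N ->
  exists K : R, 0 <= K /\ forall J, (0 < J)%N -> exists N, forall n, (N <= n)%N ->
    \sum_(PQ : {set 'I_n} * {set 'I_n} | frob_ok PQ && close_pair M J (side b PQ))
       frob_mass z z' PQ <= K / J%:R * frob_expect z z' n (fun=> 1).
Proof.
move=> /frob_mass_kappa[w [w' [kappa [[w0 w'0 k0] reg reg' massE]]]] M0.
have expect1 n : frob_expect z z' n (fun=> 1) =
    \sum_(PQ : {set 'I_n} * {set 'I_n} | frob_ok PQ)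
      kappa n #|PQ.1| * frob_weight w w' PQ.1 PQ.2.
  by apply: eq_bigr => PQ ok; rewrite mulr1 massE.
have K0 (C : R) : 0 <= C -> 0 <= 64 * M%:R ^+ 3 * (C ^+ 2 * move_const R M ^+ 4).
  by move=> C0; rewrite !mulr_ge0 ?exprn_ge0 // mulr_ge0 ?expR_ge0.
case: b.
  have [C [N [C0 regC]]] := reg M M0.
  exists (64 * M%:R ^+ 3 * (C ^+ 2 * move_const R M ^+ 4)); split; first exact: K0.
  move=> J J0; exists (maxn N (maxn (64 * M ^ 2) J)) => n.
  rewrite !geq_max => /and3P[Nn Mn Jn].
  rewrite expect1; under eq_bigr => PQ /andP[ok _] do rewrite massE //.
  exact: (close_pair_mass M0 Mn (k0 n) w0 w'0 C0 (regC n Nn) J0 Jn).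
have [C [N [C0 regC]]] := reg' M M0.
exists (64 * M%:R ^+ 3 * (C ^+ 2 * move_const R M ^+ 4)); split; first exact: K0.
move=> J J0; exists (maxn N (maxn (64 * M ^ 2) J)) => n.
rewrite !geq_max => /and3P[Nn Mn Jn].
have swapK : involutive (fun PQ : {set 'I_n} * {set 'I_n} => (PQ.2, PQ.1)).
  by case.
have massE' (PQ : {set 'I_n} * {set 'I_n}) : frob_ok PQ ->
    kappa n #|PQ.2| * frob_weight w w' PQ.2 PQ.1 =
    kappa n #|PQ.1| * frob_weight w' w PQ.1 PQ.2.
  by move=> /andP[/eqP -> _]; rewrite frob_weight_swap.
rewrite expect1; under eq_bigr => PQ /andP[ok _] do rewrite massE //.
rewrite (reindex_inj (inv_inj swapK)) [X in _ <= _ * X](reindex_inj (inv_inj swapK)) /=.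
under eq_bigl => PQ do rewrite frob_ok_swap.
under [X in _ <= _ * X]eq_bigl => PQ do rewrite frob_ok_swap.
under eq_bigr => PQ /andP[ok _] do rewrite massE' //.
under [X in _ <= _ * X]eq_bigr => PQ ok do rewrite massE' //.
exact: (close_pair_mass M0 Mn (k0 n) w'0 w0 C0 (regC n Nn) J0 Jn).
Qed.

End CloseMass.

Local Open Scope classical_set_scope.

(** * A continuous test function detecting close coordinates *)

Section TestFunction.
Variables (R : realType) (M J i : nat).

(** For coordinates in decreasing order and at most 1, positivity forces [a i.+1 > 2 / M] and
    [a i - a i.+1 < 1 / J]. *)
Definition closeness (a : nat -> R) : R :=
  M%:R * a i.+1 - 2 - J%:R * M%:R * (a i - a i.+1).

(** Twice the positive part of [closeness]. *)
Definition close_test (a : nat -> R) : R := closeness a + `|closeness a|.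

Lemma close_test_ge0 a : 0 <= close_test a.
Proof. by rewrite /close_test -lerBlDl sub0r -normrN ler_norm. Qed.

Lemma close_test_frob_point (b : bool) (n : nat) (PQ : {set 'I_n} * {set 'I_n}) :
  (0 < M)%N -> (M <= n)%N ->
  close_test (side b (frob_point R PQ)) <=
  2 * M%:R * (close_pair M J (side b PQ))%:R.
Proof.
move=> M0 Mn; set A := side b PQ.
have -> : side b (frob_point R PQ) =
    (fun k => if (k < size (dec_list A))%N
              then ((nth 0%N (dec_list A) k)%:R + 2^-1) / n%:R else 0).
  by rewrite /A /frob_point; case: (b).
set a := (fun k => _).
have n0 : (0 < n)%N by apply: leq_trans Mn.
have nR : 0 < n%:R :> R by rewrite ltr0n.
have MR : 0 < M%:R :> R by rewrite ltr0n.
rewrite /close_test.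
have [u0|u0] := leP (closeness a) 0.
  by rewrite (ler0_norm u0) subrr !mulr_ge0.
rewrite (gtr0_norm u0).
(* Past the end of the list a coordinate is [0] by default, and [closeness] would be at most
   [-2]. *)
have sz : (i.+1 < size (dec_list A))%N.
  rewrite ltnNge; apply/negP => le; move: u0.
  rewrite /closeness {1}/a ltnNge le /= mulr0.
  have a0 k : 0 <= a k.
    by rewrite /a; case: ifP => // _; rewrite divr_ge0 // addr_ge0 ?invr_ge0.
  rewrite {2}/a ltnNge le /= subr0 => u0.
  have : 0 <= J%:R * M%:R * a i by rewrite !mulr_ge0.
  lra.
have szi : (i < size (dec_list A))%N by apply: ltn_trans sz.
set p := nth 0%N (dec_list A) i; set p' := nth 0%N (dec_list A) i.+1.
have ai : a i = (p%:R + 2^-1) / n%:R by rewrite /a szi.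
have ai1 : a i.+1 = (p'%:R + 2^-1) / n%:R by rewrite /a sz.
have memA k : (k < size (dec_list A))%N ->
    exists2 x : 'I_n, x \in A & val x = nth 0%N (dec_list A) k.
  move=> kd; have := mem_nth 0%N kd.
  rewrite (perm_mem (perm_dec_list A)) => /mapP[x]; rewrite mem_enum => xA xE.
  by exists x.
have [x xA xE] := memA _ szi; have [x' x'A x'E] := memA _ sz.
have p'p : (p' < p)%N.
  rewrite ltn_neqAle nth_uniq ?uniq_dec_list // gtn_eqF //=.
  have /(sortedP 0%N) : sorted (fun a b => b <= a)%N (dec_list A).
    by apply: sort_sorted => ? ?; exact: leq_total.
  exact.
have p'n : (p' < n)%N by rewrite /p' -x'E ltn_ord.
have dist : a i - a i.+1 = (p - p')%:R / n%:R.
  by rewrite ai ai1 natrB 1?ltnW // -mulrBl; congr (_ / _); lra.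
have a1 : a i.+1 <= 1.
  rewrite ai1 ler_pdivrMr // mul1r.
  have : p'.+1%:R <= n%:R :> R by rewrite ler_nat.
  by rewrite -natr1; lra.
have d0 : 0 <= a i - a i.+1 by rewrite dist divr_ge0.
have Jd0 : 0 <= J%:R * M%:R * (a i - a i.+1) by rewrite !mulr_ge0.
have close : close_pair M J A.
  apply/exists_inP; exists x => //; apply/exists_inP; exists x' => //.
  rewrite -[nat_of_ord x]/(val x) -[nat_of_ord x']/(val x') xE x'E p'p /=.
  move: u0; rewrite /closeness => u0; apply/andP; split.
    have : J%:R * (a i - a i.+1) < 1.
      rewrite -(ltr_pM2l MR) mulrA [M%:R * J%:R]mulrC mulr1.
      have : M%:R * a i.+1 <= M%:R * 1 by rewrite ler_pM2l.
      by lra.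
    by rewrite dist mulrA ltr_pdivrMr // mul1r -natrM ltr_nat.
  (* The shift by one half costs at most [M / 2 <= n / 2], which the 2 in [closeness] absorbs. *)
  have : 2 < M%:R * a i.+1 by lra.
  rewrite ai1 mulrA ltr_pdivlMr // mulrDr -natrM => big.
  have : M%:R <= n%:R :> R by rewrite ler_nat.
  by rewrite -(ler_nat R) => ?; lra.
rewrite close mulr1.
have : M%:R * a i.+1 <= M%:R * 1 by rewrite ler_pM2l.
by rewrite /closeness; lra.
Qed.

Lemma close_test_cont (b : bool) : cont_on_thoma (fun w : pt R => close_test (side b w)).
Proof.
move=> x y _ _ cv1 cv2.
have cv k : (fun m => side b (x m) k) @ \oo --> side b y k.
  by case: b; [exact: cv1 | exact: cv2].
have cvu : (fun m => closeness (side b (x m))) @ \oo --> closeness (side b y).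
  apply: cvgB; last by apply: cvgMl_tmp; apply: cvgB.
  by apply: cvgB; [apply: cvgMl_tmp | exact: cvg_cst].
by apply: cvgD => //; exact: cvg_norm.
Qed.

Lemma measurable_close_test d (T : measurableType d) (a : T -> nat -> R) :
  (forall k, measurable_fun setT (fun t => a t k)) ->
  measurable_fun setT (fun t => close_test (a t)).
Proof.
move=> ma.
have mu : measurable_fun setT (fun t => closeness (a t)).
  apply: measurable_funB; last by apply: measurable_funM => //; apply: measurable_funB.
  by apply: measurable_funB => //; apply: measurable_funM.
apply: measurable_funD => //.
by apply: (measurableT_comp (@normr_measurable _ _)).
Qed.

End TestFunction.

(** * Passage to the limit and almost sure absence of ties *)

Section NoTies.
Variables (R : realType) (z z' : R[i]).
Variables (d : measure_display) (T : measurableType d) (P : probability T R).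
Variable X : T -> pt R.
Hypothesis zz' : admissible z z'.
Hypothesis X_thoma : forall t, thoma (X t).
Hypothesis X_meas : forall b i, measurable_fun setT (fun t => side b (X t) i).
Hypothesis X_lim : forall f : pt R -> R, cont_on_thoma f ->
  ((fun n => (frob_expect z z' n f)%:E) @ \oo --> \int[P]_t (f (X t))%:E)%E.

(** For the constant test function 1 the weak limit is the total mass 1 of [P]. *)
Lemma total_mass_le2 : \forall n \near \oo, frob_expect z z' n (fun=> 1) <= 2.
Proof.
have c1 : cont_on_thoma (fun _ : pt R => 1) by move=> *; exact: cvg_cst.
have := X_lim c1; rewrite integral_cst //= probability_setT mule1.
move=> /fine_cvgP[_ /cvgr_le]; apply.
by rewrite ltr1n.
Qed.

(** The test is at most [2 * M] and vanishes without a close pair; the total mass contributes the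
    other factor 2. *)
Lemma expect_close_test (b : bool) (M i : nat) : (0 < M)%N ->
  exists K : R, forall J, (0 < J)%N ->
    (\int[P]_t (close_test M J i (side b (X t)))%:E <= (K / J%:R)%:E)%E.
Proof.
move=> M0; have [K [K0 HK]] := close_pair_frob_mass b zz' M0.
exists (4 * M%:R * K) => J J0; have [N HN] := HK J J0.
have JR : 0 < J%:R :> R by rewrite ltr0n.
have cv := X_lim (@close_test_cont R M J i b).
apply: (cvge_to_le cv).
near=> n.
have Nn : (N <= n)%N by near: n; exact: nbhs_infty_ge.
have Mn : (M <= n)%N by near: n; exact: nbhs_infty_ge.
have le2 : frob_expect z z' n (fun=> 1) <= 2 by near: n; exact: total_mass_le2.
rewrite lee_fin.
apply: (@le_trans _ _ (2 * M%:R * \sum_(PQ : {set 'I_n} * {set 'I_n} |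
    frob_ok PQ && close_pair M J (side b PQ)) frob_mass z z' PQ)).
  rewrite [X in _ * X]big_mkcondr mulr_sumr; apply: ler_sum => PQ ok.
  have le_close := @close_test_frob_point R M J i b n PQ M0 Mn.
  apply: (le_trans (ler_wpM2l (frob_mass_ge0 zz' ok) le_close)).
  by case: ifP => _; rewrite ?mulr0 // mulr1 mulrC.
rewrite (_ : 4 * _ * _ / _ = 2 * M%:R * (K / J%:R * 2)); last by ring.
rewrite ler_wpM2l ?mulr_ge0 //; apply: le_trans (HN n Nn) _.
by rewrite ler_wpM2l ?divr_ge0.
Unshelve. all: by end_near. Qed.

(** A tie at height at least [4 / (M + 1)] makes [close_test] at least 4 for every [J], so Markov's
    inequality bounds its probability by [K / J], with [J] arbitrary. Positive ties are the
    countable union of these events. *)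
Lemma ae_no_tie (b : bool) (i : nat) :
  {ae P, forall t, side b (X t) i = side b (X t) i.+1 -> side b (X t) i = 0}.
Proof.
pose A M := [set t | side b (X t) i = side b (X t) i.+1] `&`
            [set t | 4 <= M.+1%:R * side b (X t) i].
have mA M : measurable (A M).
  apply: measurableI.
    have /(_ measurableT [set true] I) := measurable_fun_eqr (X_meas b i) (X_meas b i.+1).
    rewrite setTI; congr measurable; apply/seteqP.
    by split => t /= /eqP.
  have m2 : measurable_fun setT (fun t => M.+1%:R * side b (X t) i).
    by apply: measurable_funM.
  have m1 : measurable_fun setT (fun _ : T => 4 : R) by exact: measurable_cst.
  have /(_ measurableT [set true] I) := measurable_fun_ler m1 m2.
  by rewrite setTI.
have A0 M : P (A M) = 0%E.
  have [K HK] := expect_close_test b i (ltn0Sn M).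
  have le J : (0 < J)%N -> (P (A M) <= (K / J%:R)%:E)%E.
    move=> J0; apply: le_trans (HK J J0).
    have m : measurable_fun setT (fun t => (close_test M.+1 J i (side b (X t)))%:E).
      by apply/measurable_EFinP; apply: measurable_close_test.
    have := le_integral_abse P measurableT m (ltr01 : 0 < 1 :> R).
    rewrite mul1e setTI => H.
    rewrite (eq_integral (fun t => `|(close_test M.+1 J i (side b (X t)))%:E|%E)); last first.
      by move=> t _; rewrite gee0_abs // lee_fin close_test_ge0.
    apply: le_trans H; apply: le_measure; rewrite ?inE //.
      rewrite -[X in measurable X]setTI.
      by apply: emeasurable_fun_c_infty => //; exact: measurableT_comp.
    move=> t [/= tie big].
    rewrite lee_fin ger0_norm ?close_test_ge0 // /close_test /closeness -tie subrr mulr0 subr0.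
    by rewrite ger0_norm; lra.
  have r0 : 0 <= fine (P (A M)) by rewrite fine_ge0.
  have PE : P (A M) = (fine (P (A M)))%:E by rewrite fineK // fin_num_measure.
  rewrite PE; congr (_%:E); apply/eqP; rewrite eq_le r0 andbT leNgt; apply/negP => rpos.
  (* Any [J] above [K / P (A M)] contradicts the bound [le]. *)
  pose J := (Num.truncn (K / fine (P (A M)))).+1.
  have := le J (ltn0Sn _); rewrite PE lee_fin ler_pdivlMr // leNgt => /negP; apply.
  rewrite mulrC -ltr_pdivrMr //; exact: truncnS_gt.
have ae_all : {ae P, forall t, forall M, ~ A M t}.
  apply: ae_foralln => M; exists (A M).
  by split; [exact: mA | exact: A0 | move=> t /= /contrapT].
apply: filterS ae_all => t noA tie; apply/eqP; apply/negPn/negP => nz.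
have a0 : 0 < side b (X t) i.
  rewrite lt_neqAle eq_sym nz /= tie.
  by have [h1 [h2 _]] := X_thoma t; case: (b); [have /andP[] := h1 i | have /andP[] := h2 i].
apply: (noA (Num.truncn (4 / side b (X t) i))); split => //=.
by rewrite -ler_pdivrMr // ltW // truncnS_gt.
Qed.

End NoTies.

(* P_{zz'} is represented as the law of a random point X of Omega defined on a
   probability space; it is characterized as the weak limit of P^(n)_{zz'}. *)
Theorem theorem2p5p1 (R : realType) (z z' : R[i])
  (d : measure_display) (T : measurableType d) (P : probability T R)
  (X : T -> pt R) :
  admissible z z' ->
  (forall t, thoma (X t)) ->
  (forall i, measurable_fun setT (fun t => (X t).1 i)) ->
  (forall i, measurable_fun setT (fun t => (X t).2 i)) ->
  (forall f : pt R -> R, cont_on_thoma f ->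
     ((fun n => (frob_expect z z' n f)%:E) @ \oo -->
        \int[P]_t (f (X t))%:E)%E) ->
  {ae P, forall t, simple_config (X t)}.
Proof.
move=> adm Xth m1 m2 lim.
have m b i : measurable_fun setT (fun t => side b (X t) i).
  by case: b; [exact: m1 | exact: m2].
have noties b := ae_foralln (fun i => @ae_no_tie R z z' d T P X adm Xth m lim b i).
apply: filterS2 (noties true) (noties false) => t no1 no2.
have [mono1 [mono2 _]] := Xth t.
(* By monotonicity, a tie between distant indices forces one between neighbours. *)
have simple (a : nat -> R) : (forall i, 0 <= a i.+1 <= a i) ->
    (forall i, a i = a i.+1 -> a i = 0) ->
    forall i j, (i < j)%N -> a i = a j -> a i = 0.
  move=> mono no i j ij aij; apply: no; apply/eqP.
  have anti : {homo a : k l / (k <= l)%N >-> l <= k}.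
    apply: homo_leq => // [x y w|k]; first by move=> h1 h2; exact: le_trans h2 h1.
    by have /andP[] := mono k.
  by rewrite eq_le; have /andP[_ ->] := mono i; rewrite andbT aij anti.
have distinct (a : nat -> R) : (forall i, 0 <= a i.+1 <= a i) ->
    (forall i, a i = a i.+1 -> a i = 0) ->
    forall i j, i <> j -> a i != 0 -> a i != a j.
  move=> mono no i j ij ai0; apply/eqP => aij; move/eqP: ai0; apply.
  have [lt|lt|//] := ltngtP i j; first exact: (simple a mono no i j).
  by rewrite aij; apply: (simple a mono no j i).
move=> i j ij; split; [exact: distinct mono1 no1 i j ij | exact: distinct mono2 no2 i j ij].
Qed.
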